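(* Let $\mathcal H$ be a real Hilbert space, let $A:\mathcal H\to 2^{\mathcal H}$ be a maximal monotone operator, let $\Psi:\mathcal H\to[0,+\infty]$ be a closed convex proper function such that $C:=\operatorname{argmin}\Psi=\Psi^{-1}(0)\neq\emptyset$, and let $\beta:[0,+\infty)\to(0,+\infty)$ be a measurable function with $\beta(t)\to+\infty$ as $t\to+\infty$. Assume that: (a) $A+N_C$ is a maximal monotone operator and $S:=(A+N_C)^{-1}(0)$ is nonempty; (b) for every $p\in R(N_C)$, $$\int_0^{+\infty}\beta(t)\left[\Psi^*\left(\frac{p}{\beta(t)}\right)-\sigma_C\left(\frac{p}{\beta(t)}\right)\right]dt<+\infty .$$ Then for every strong solution $x:[0,+\infty)\to\mathcal H$ of the differential inclusion $$\dot x(t)+A(x(t))+\beta(t)\,\partial\Psi(x(t))\ni 0$$ the following hold: (i) there exists $x_\infty\in S$ such that $\frac1t\int_0^t x(s)\,ds$ converges weakly to $x_\infty$ as $t\to+\infty$; (ii) for every $z\in S$, $\lim_{t\to+\infty}\|x(t)-z\|$ exists; (iii) $\int_0^{+\infty}\beta(t)\Psi(x(t))\,dt<+\infty$.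
   Context: Closed means lower semicontinuous. $\partial\Psi$ is the convex subdifferential: $u\in\partial\Psi(x)$ iff $\Psi(y)\ge\Psi(x)+\langle u,y-x\rangle$ for all $y\in\mathcal H$. $\Psi^*(y)=\sup_{x\in\mathcal H}\{\langle y,x\rangle-\Psi(x)\}$ is the Fenchel conjugate, $\sigma_C(y)=\sup_{x\in C}\langle y,x\rangle$ is the support function of $C$, $N_C(x)$ is the outward normal cone to $C$ at $x$ ($p\in N_C(x)$ iff $x\in C$ and $\langle p,y-x\rangle\le 0$ for all $y\in C$), and $R(N_C)$ is its range: $p\in R(N_C)$ iff $p\in N_C(x)$ for some $x\in C$. A strong solution of $\dot x(t)+A(x(t))+\beta(t)\partial\Psi(x(t))\ni0$ is a function $x:[0,+\infty)\to\mathcal H$ that is continuous on $[0,+\infty)$, absolutely continuous on every bounded interval $[0,T]$ (hence differentiable almost everywhere), and for which there exist functions $\xi(\cdot),\eta(\cdot)$ with $\xi(t)\in A(x(t))$, $\eta(t)\in\partial\Psi(x(t))$ and $\dot x(t)+\xi(t)+\beta(t)\eta(t)=0$ for almost every $t>0$. *)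

(* Defs.v *)
From HB Require Import structures.
From mathcomp Require Import all_boot all_order all_algebra.
From mathcomp Require Import all_classical all_reals all_analysis.
Set Implicit Arguments.
Unset Strict Implicit.
Unset Printing Implicit Defensive.
Import Order.TTheory GRing.Theory Num.Theory.
Import numFieldNormedType.Exports.
Local Open Scope classical_set_scope.
Local Open Scope ring_scope.

(* A set-valued operator A : H -> 2^H is a function H -> set H: [A x u] reads
   "u belongs to A(x)". *)
Section operators.
Context {R : realType} {H : completeNormedModType R}.
Variable ip : {dot H for idfun}.
Implicit Types (A B : H -> set H) (C : set H).

Definition monotone_op A :=
  forall x y u v, A x u -> A y v -> 0 <= ip (u - v) (x - y).

Definition maximal_monotone A :=
  monotone_op A /\
  forall B, monotone_op B -> (forall x, A x `<=` B x) ->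
    forall x, B x `<=` A x.

Definition op_add A B : H -> set H :=
  fun x => [set u + v | u in A x & v in B x].

Definition op_inv A : H -> set H := fun u => [set x | A x u].

Definition op_range A : set H := [set u | exists x, A x u].

Definition normal_cone C : H -> set H :=
  fun x => [set p | C x /\ forall y, C y -> ip p (y - x) <= 0].

End operators.

Section convex_analysis.
Context {R : realType} {H : completeNormedModType R}.
Variable ip : {dot H for idfun}.
Implicit Types (f : H -> \bar R) (C : set H).
Local Open Scope ereal_scope.

Definition proper_efun f :=
  (forall x, -oo < f x) /\ exists x, f x < +oo.

(* Meant for functions that never take the value -oo, so that the right-hand
   side is not of the form (-oo) + (+oo). *)
Definition convex_efun f := forall (x y : H) (a : R), (0 < a < 1)%R ->
  f (a *: x + (1 - a) *: y)%R <= a%:E * f x + (1 - a)%:E * f y.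

Definition argmin f : set H := [set x | forall y, f x <= f y].

Definition subdifferential f : H -> set H :=
  fun x => [set u | forall y, f x + (ip u (y - x)%R)%:E <= f y].

Definition fenchel_conjugate f (y : H) : \bar R :=
  ereal_sup [set (ip y x)%:E - f x | x in setT].

Definition support_function C (y : H) : \bar R :=
  ereal_sup [set (ip y x)%:E | x in C].

End convex_analysis.

Section vector_valued_functions.
Context {R : realType} {H : completeNormedModType R}.
Local Notation mu := (@lebesgue_measure R).
Implicit Types (f x : R -> H) (D : set R).

Definition weakly_cvg (ip : {dot H for idfun}) f (F : set_system R) (l : H) :=
  forall y, ip (f t) y @[t --> F] --> ip l y.

Definition abs_continuous x (a b : R) :=
  forall e : R, 0 < e -> exists2 d : R, 0 < d &
    forall (n : nat) (u v : 'I_n -> R),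
      (forall i, a <= u i /\ u i <= v i /\ v i <= b) ->
      trivIset setT (fun i => `]u i, v i[%classic) ->
      \sum_(i < n) (v i - u i) < d ->
      \sum_(i < n) `|x (v i) - x (u i)| < e.

(* [v] is the Bochner integral of [f] over [D]: [f] is, almost everywhere and
   in L^1-norm, the limit of the simple functions
     s m := \sum_(i < k m) \1_(E m i) *: c m i
   and [v] is the limit of the integrals of the [s m]. *)
Definition is_bochner_integral D f (v : H) :=
  exists (k : nat -> nat) (E : nat -> nat -> set R) (c : nat -> nat -> H),
    let s m r := \sum_(i < k m) (\1_(E m i) r : R) *: c m i in
    [/\ forall m i, [/\ measurable (E m i), E m i `<=` D
          & (mu (E m i) < +oo)%E],
        {ae mu, forall r, D r -> s m r @[m --> \oo] --> f r},
        (\int[mu]_(r in D) (`|f r - s m r|)%:E)%E @[m --> \oo] --> 0%E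
      & \sum_(i < k m) fine (mu (E m i)) *: c m i @[m --> \oo] --> v].

(* By convention 0 when [f] is not Bochner integrable over [D]. *)
Definition bochner_integral D f : H := xget 0 (is_bochner_integral D f).

End vector_valued_functions.

(* [x] is only meaningful on [0, +oo[; the derivative is only taken at t > 0. *)
Definition strong_solution {R : realType} {H : completeNormedModType R}
    (ip : {dot H for idfun}) (A : H -> set H) (Psi : H -> \bar R)
    (beta : R -> R) (x : R -> H) :=
  [/\ {within `[0, +oo[, continuous x},
      forall T : R, 0 <= T -> abs_continuous x 0 T
    & exists xi eta : R -> H, {ae @lebesgue_measure R, forall t, 0 < t ->
        [/\ A (x t) (xi t), subdifferential ip Psi (x t) (eta t),
            derivable x t 1
          & (x^`())%classic t + xi t + beta t *: eta t = 0]}].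

(* Main.v *)
Require Import Defs.
From HB Require Import structures.
From mathcomp Require Import all_boot all_order all_algebra.
From mathcomp Require Import all_classical all_reals all_analysis.
From mathcomp Require Import measurable_realfun ring lra.
Import Order.TTheory GRing.Theory Num.Theory.
Import numFieldNormedType.Exports.
Local Open Scope classical_set_scope.
Local Open Scope ring_scope.

(** Everything comes from one Lyapunov function. Fix [z] and [u] in [A z], [p] in
[N_C z], put [y = u + p] and [e t = |x t - z|^2 / 2]. Testing the inclusion at
[x t] against [z], monotonicity of [A] and the subgradient inequality for [Psi]
(which vanishes at [z]) give, for almost every [t],

  e' + beta Psi(x) + <y, x - z> <= <p, x - z>.

The right-hand side is linear in [x - z] and is absorbed by the penalty: Young's
inequality gives [<p, x - z> - beta Psi(x) <= g_p], where
[g_p = beta (Psi^*(p / beta) - sigma_C(p / beta))] is the integrand of the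
hypothesis, because the support function of [C] in the direction [p] is attained
at [z]. Hence [e' + <y, x - z> <= g_p] with [g_p] integrable; [energy_growth] is
the integrated form.

Case [y = 0], that is [z] in [S]: [e] minus the primitive of [g_p] is
nonincreasing and bounded below, so [e] converges ([energy_cvg]). Spending only
half of the penalty on Young's inequality, now for the normal [2 p], leaves
[beta Psi(x) / 2] on the left, hence its integral is finite
([penalty_integral_lt]).

General [y]: dividing by [t] gives [<y, X t - z> <= O(1/t)] for the time averages
[X t] of [x]. Every weak cluster point [v] of [X] is therefore monotonically
related to the whole graph of [A + N_C] and lies in [S] by maximality
([average_cluster_zero]). For two cluster points [v], [w] the function
[<x t, v - w>] is an affine function of [|x t - w|^2 - |x t - v|^2], so it
converges, and so do its Cesaro means [<X t, v - w>]; this forces [v = w], and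
Opial's lemma ([opial]) yields weak convergence.

Three analytic tools carry the argument. An absolutely continuous function whose
derivative is almost everywhere at most [q] grows by at most the integral of [q]
([abs_continuous_le_Rintegral]). The Riesz representation theorem
([riesz_representation]) produces vectors from bounded linear forms: it builds the
Bochner integral of the trajectory and the weak limits along ultrafilters, which
replace weak compactness. Finally the Bochner integral is handled only through its
pairings with vectors ([ip_bochner_integral]). *)

(** * Inner products and the Riesz representation *)

Section inner_product.
Context {R : realType} {H : completeNormedModType R}.
Variable ip : {dot H for idfun}.
Hypothesis ip_norm : forall x : H, ip x x = `|x| ^+ 2.

Lemma ipC x y : ip x y = ip y x.
Proof. by have := @hermitian_subproof _ _ _ _ ip x y; rewrite expr0 mul1r. Qed.

Lemma ipDl x y z : ip (x + y) z = ip x z + ip y z.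
Proof. by rewrite linearDl. Qed.
Lemma ipDr x y z : ip z (x + y) = ip z x + ip z y.
Proof. by rewrite linearDr. Qed.
Lemma ipBl x y z : ip (x - y) z = ip x z - ip y z.
Proof. by rewrite linearBl. Qed.
Lemma ipBr x y z : ip z (x - y) = ip z x - ip z y.
Proof. by rewrite linearBr. Qed.
Lemma ipZl a x z : ip (a *: x) z = a * ip x z.
Proof. by rewrite linearZl_LR. Qed.
Lemma ipZr a x z : ip z (a *: x) = a * ip z x.
Proof. by rewrite linearZr_LR. Qed.
Lemma ipNl x z : ip (- x) z = - ip x z.
Proof. by rewrite linearNl. Qed.
Lemma ip_suml (I : Type) (r : seq I) (P : pred I) (F : I -> H) z :
  ip (\sum_(i <- r | P i) F i) z = \sum_(i <- r | P i) ip (F i) z.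
Proof. exact: linear_sumlz. Qed.
Lemma ip0l z : ip 0 z = 0.
Proof. by rewrite linear0l. Qed.

Lemma sqr_normD x y : `|x + y| ^+ 2 = `|x| ^+ 2 + 2 * ip x y + `|y| ^+ 2.
Proof. by rewrite -!ip_norm ipDl !ipDr (ipC y x); ring. Qed.

Lemma sqr_normB x y : `|x - y| ^+ 2 = `|x| ^+ 2 - 2 * ip x y + `|y| ^+ 2.
Proof. by rewrite -!ip_norm ipBl !ipBr (ipC y x); ring. Qed.

Lemma cauchy_schwarz x y : `|ip x y| <= `|x| * `|y|.
Proof.
have [->|y0] := eqVneq y 0.
  by rewrite ipC ip0l !normr0 mulr0.
have ny : 0 < `|y| by rewrite normr_gt0.
rewrite -(@ler_pXn2r _ 2%N) ?nnegrE ?mulr_ge0// real_normK ?num_real// exprMn.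
have := sqr_ge0 (`| `|y| ^+ 2 *: x - ip x y *: y |).
rewrite sqr_normB ipZl ipZr !normrZ !exprMn !real_normK ?num_real//.
rewrite (_ : _ + _ = `|y| ^+ 2 * (`|x| ^+ 2 * `|y| ^+ 2 - ip x y ^+ 2)); last by ring.
by rewrite pmulr_rge0 ?exprn_gt0// subr_ge0.
Qed.

Lemma ip_continuousl y : continuous (fun x : H => ip x y).
Proof.
move=> x; apply/cvgrPdist_le => e e0 /=.
near=> z; rewrite -ipBl (le_trans (cauchy_schwarz _ _))//.
have /ltW : `|x - z| < e / (`|y| + 1).
  near: z; apply: cvgr_dist_lt; first exact: cvg_id.
  by rewrite divr_gt0// ltr_wpDl.
rewrite ler_pdivlMr ?ltr_wpDl//; apply: le_trans.
by rewrite ler_wpM2l// lerDl.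
Unshelve. all: by end_near. Qed.

(** The vector is the minimiser of |v|^2 - 2 l(v): the parallelogram identity
makes minimising filters Cauchy, so completeness provides the minimum, and the
first-order condition at the minimum is the representation formula. *)
Lemma riesz_representation (l : H -> R) (M : R) :
  (forall u v, l (u + v) = l u + l v) -> (forall a v, l (a *: v) = a * l v) ->
  (forall v, `|l v| <= M * `|v|) ->
  exists v, forall y, ip v y = l y.
Proof.
move=> lD lZ lM.
pose phi v : R := `|v| ^+ 2 - 2 * l v.
have phi_ge v : - M ^+ 2 <= phi v.
  rewrite /phi; have := lM v; rewrite ler_norml => /andP[_].
  have := sqr_ge0 (`|v| - M); nra.
have phiR : has_inf (range phi).
  split; first by exists (phi 0), 0.
  by exists (- M ^+ 2) => _ [v _ <-].
set m := inf (range phi).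
have m_le v : m <= phi v by apply: ge_inf; [exact: phiR.2|exists v].
have par a b : `|a - b| ^+ 2 = 2 * phi a + 2 * phi b - 4 * phi (2^-1 *: (a + b)).
  rewrite /phi lZ lD sqr_normB normrZ exprMn sqr_normD.
  by rewrite ger0_norm ?invr_ge0//; field.
have phi_near a b : `|phi a - phi b| <= `|a - b| * (`|a - b| + 2 * `|b| + 2 * M).
  have -> : phi a - phi b = `|a - b| ^+ 2 + 2 * ip (a - b) b - 2 * l (a - b).
    have {1}-> : a = (a - b) + b by rewrite subrK.
    by rewrite /phi lD (sqr_normD (a - b)); ring.
  have := cauchy_schwarz (a - b) b; have := lM (a - b).
  rewrite !ler_norml => /andP[? ?] /andP[? ?].
  by have := sqr_ge0 `|a - b| => ?; apply/andP; split; nra.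
pose F := filter_from [set e : R | 0 < e] (fun e => [set v | phi v < m + e]).
have FF : ProperFilter F.
  apply: filter_from_proper; last first.
    move=> e /= e0; have [_ [v _ <-] ve] := inf_adherent e0 phiR.
    by exists v.
  apply: filter_from_filter; first by exists 1 => /=.
  move=> a b /= a0 b0; exists (Num.min a b); first by rewrite /= lt_min a0.
  by move=> v /= vab; split => /=; apply: lt_le_trans vab _; rewrite lerD2l ge_min lexx ?orbT.
have cF : cauchy F.
  apply/cauchy_exP => e /= e0.
  have d0 : 0 < e ^+ 2 / 4 by rewrite divr_gt0// exprn_gt0.
  have [_ [v _ <-] vm] := inf_adherent d0 phiR.
  exists v; exists (e ^+ 2 / 4) => //= w wm.
  rewrite -ball_normE /ball_/= -(@ltr_pXn2r _ 2%N) ?nnegrE ?(ltW e0)//.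
  rewrite par; have := m_le (2^-1 *: (v + w)); move: vm wm; rewrite -/m /=; lra.
have Fv : F --> lim F := @cauchy_cvg _ F FF cF.
set v := lim F in Fv.
have phiv : phi v <= m.
  apply/ler_addgt0Pr => e e0.
  set K : R := 1 + 2 * `|v| + 2 * `|M|.
  have K0 : 0 < K by rewrite /K !ltr_wpDr.
  have e20 : 0 < e / 2 by rewrite divr_gt0.
  have d0 : 0 < Num.min 1 (e / 2 / K) by rewrite lt_min ltr01 divr_gt0.
  have Fb : F (ball v (Num.min 1 (e / 2 / K))).
    by apply: Fv; exact: nbhsx_ballx.
  have Fe : F [set w | phi w < m + e / 2] by exists (e / 2).
  have [w [wb we]] := filter_ex (filterI Fb Fe).
  move: wb we; rewrite -ball_normE /ball_/= lt_min distrC => /andP[w1].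
  rewrite ltr_pdivlMr// => wK we.
  have := phi_near w v; rewrite ler_norml => /andP[+ _].
  have : `|w - v| * (`|w - v| + 2 * `|v| + 2 * M) <= `|w - v| * K.
    by rewrite ler_wpM2l// /K; have := ler_norm M; lra.
  lra.
(* Adding 1 to the squared norm of [y] keeps the descent step defined for [y = 0]. *)
exists v => y; apply/eqP; rewrite -subr_eq0; apply/negP => /negP c0.
set c := ip v y - l y in c0.
have n0 : 0 < `|y| ^+ 2 + 1 by rewrite ltr_wpDl// sqr_ge0.
have := m_le (v + (- c / (`|y| ^+ 2 + 1)) *: y).
rewrite leNgt => /negP; apply; apply: lt_le_trans phiv.
have c20 : 0 < c ^+ 2 by rewrite exprn_even_gt0.
rewrite -subr_gt0 /phi sqr_normD lD lZ normrZ exprMn ipZr real_normK ?num_real//.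
rewrite [ltRHS](_ : _ = c ^+ 2 * (`|y| ^+ 2 + 2) / (`|y| ^+ 2 + 1) ^+ 2); last first.
  by rewrite /c; field; rewrite gt_eqF.
by rewrite divr_gt0 ?exprn_gt0// mulr_gt0// ltr_wpDl// sqr_ge0.
Qed.
End inner_product.

(** * Growth of absolutely continuous functions *)

Section absolutely_continuous_functions.
Context {R : realType}.
Local Notation mu := (@lebesgue_measure R).

(** The form in which a nonpositive derivative at [t] is used: a chain of
intervals crosses [t] by an interval [u, v] around [t], which need not start or
end there. *)
Definition small_increment (F : R -> R) (t : R) :=
  forall e, 0 < e -> exists2 d, 0 < d &
    forall u v, u <= t -> t <= v -> v - u < d -> F v - F u <= e * (v - u).

Lemma derivable_small_increment (F : R -> R) t :
  derivable F t 1 -> F^`()%classic t <= 0 -> small_increment F t.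
Proof.
move=> dF F0 e e0.
have /cvgrPdist_lt/(_ _ e0) : h^-1 *: (F (h + t) - F t) @[h --> 0^'] --> F^`()%classic t.
  have := dF; rewrite /derivable /derive1 => /cvg_ex[l /= Fl].
  have Fl' : h^-1 *: (F (h + t) - F t) @[h --> 0^'] --> l.
    apply: cvg_trans Fl; apply: near_eq_cvg; near=> h.
    by rewrite /= [h *: _]mulr1.
  by rewrite (cvg_lim _ Fl').
rewrite -nbhs_nearE => /nbhs_ballP[d /= d0 dP].
have inc h : h != 0 -> `|h| < d -> h^-1 * (F (h + t) - F t) < e.
  move=> h0 hd; have := dP h; rewrite /ball/= sub0r normrN => /(_ hd h0).
  by rewrite ltr_norml => /andP[+ _]; rewrite /GRing.scale /=; lra.
exists d => // u v ut tv uvd.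
have Fv : F v - F t <= e * (v - t).
  have [->|tv'] := eqVneq t v; first by rewrite !subrr mulr0.
  have vt : 0 < v - t by rewrite subr_gt0 lt_neqAle tv'.
  have := inc (v - t); rewrite gt_eqF// gtr0_norm// subrK => /(_ isT).
  rewrite mulrC ltr_pdivrMr// => /(_ _)/ltW; apply; lra.
have Fu : F t - F u <= e * (t - u).
  have [->|tu'] := eqVneq t u; first by rewrite !subrr mulr0.
  have ut0 : 0 < t - u by rewrite subr_gt0 lt_neqAle eq_sym tu'.
  have := inc (u - t); rewrite -(opprB t u) oppr_eq0 gt_eqF// normrN gtr0_norm//.
  rewrite opprB subrK => /(_ isT).
  rewrite -(opprB t u) invrN mulNr -mulrN opprB mulrC ltr_pdivrMr// => /(_ _)/ltW.
  apply; lra.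
rewrite (_ : v - u = (v - t) + (t - u)); last by ring.
by rewrite mulrDr; lra.
Unshelve. all: by end_near. Qed.

(** Creeping along the interval: a point outside [N] is crossed by the local
estimate, a point of [N] by an interval inside an open [U] of small measure
containing [N]. The intervals of the second kind are disjoint and of small total
length, so absolute continuity bounds what [F] gains on them. *)
Lemma abs_continuous_small_increment_le (F : R -> R^o) (a b : R) (N : set R) :
  a <= b -> abs_continuous F a b -> mu.-negligible N ->
  (forall t, a <= t <= b -> ~ N t -> small_increment F t) -> F b <= F a.
Proof.
move=> ab acF [N' [mN' N'0 NN']] Finc.
suff key : forall e, 0 < e -> F b - F a <= e * (b - a) + e.
  apply/ler_addgt0Pr => e e0.
  have ba0 : 0 < b - a + 1 by rewrite ltr_wpDl// subr_ge0.
  have := key (e / (b - a + 1)); rewrite divr_gt0// => /(_ isT).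
  rewrite (_ : _ * (b - a) + _ = e); first by lra.
  by field; rewrite gt_eqF.
move=> e e0.
have [d d0 dF] := acF e e0.
have [|U [oU NU Ud]] := @lebesgue_regularity_outer R N' d mN' _ d0.
  by rewrite [X in (X < _)%E]N'0 ltry.
have {}Ud : (mu U < d%:E)%E.
  have mU : measurable U by exact: open_measurable.
  have -> : U = U `\` N' `|` N' by rewrite setUC setDUK.
  rewrite (le_lt_trans (@measureU2 _ _ _ mu _ _ (measurableD mU mN') mN'))//.
  by rewrite [X in (_ + X)%E]N'0 adde0.
(* [P t]: the point [t] has been reached, the gain so far being accounted for by
the slope [e] and by finitely many ordered intervals inside [U]. *)
pose P t := [/\ a <= t, t <= b & exists n (u v : nat -> R),
  [/\ forall i, (i < n)%N ->
        [/\ a <= u i, u i <= v i, v i <= t & `]u i, v i[%classic `<=` U],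
      forall i j, (i < j < n)%N -> v i <= u j
    & F t - F a <= e * (t - a) + \sum_(i < n) `|F (v i) - F (u i)|]].
have Pa : P a.
  split => //; exists 0%N, (fun=> 0), (fun=> 0); split=> [i|i j|]; rewrite ?ltn0 ?andbF//.
  by rewrite big_ord0 !subrr mulr0 addr0.
have PS : has_sup P by split; [exists a|exists b => t []].
set T := sup P.
have aT : a <= T by apply: sup_ubound => //; exact: PS.2.
have Tb : T <= b by apply: ge_sup; [exists a|move=> t []].
have [r r0 step] : exists2 r, 0 < r & forall t w, P t -> T - r < t -> t <= T ->
    T <= w -> w < T + r -> w <= b -> P w.
  have [NT|NT] := pselect (N T).
    have /nbhs_ballP[r /= r0 rU] : nbhs T U.
      by rewrite nbhsE; exists U => //; split => //; exact/NU/NN'.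
    exists r => // t w [at_ tb [n [u [v [uv disj Ft]]]]] Trt tT Tw wTr wb.
    split => //; first by lra.
    exists n.+1, (fun i => if (i < n)%N then u i else t),
      (fun i => if (i < n)%N then v i else w); split => [i _|i j|].
    - case: ifPn => [/uv[? ? ? ?]|_]; first by split => //; lra.
      split => //; [lra..|move=> s /=].
      rewrite in_itv/= => /andP[ts sw]; apply: rU.
      by rewrite /ball/= ltr_norml; apply/andP; split; lra.
    - rewrite ltnS => /andP[ij jn]; rewrite (leq_trans ij)//.
      case: ifPn => jn'; first by apply: disj; rewrite ij.
      by have [] := uv i (leq_trans ij jn).
    - rewrite big_ord_recr/= ltnn (eq_bigr (fun i : 'I_n => `|F (v i) - F (u i)|)).
        have := ler_norm (F w - F t).
        have : e * (t - a) <= e * (w - a) by rewrite ler_pM2l//; lra.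
        lra.
      by move=> i _; rewrite ltn_ord.
  have [|r r0 inc] := Finc T _ NT e e0; first by rewrite aT.
  exists (r / 2) => [|t w [at_ tb [n [u [v [uv disj Ft]]]]] Trt tT Tw wTr wb].
    by rewrite divr_gt0.
  split => //; first by lra.
  exists n, u, v; split => [i /uv[? ? ? ?]| |] //; first by split => //; lra.
  have /(inc t w tT Tw) : w - t < r by lra.
  have -> : e * (w - a) = e * (w - t) + e * (t - a) by ring.
  lra.
(* [step] carries [P] from below [T] to [T] and beyond, as long as [b] allows. *)
have [t Pt Tt] := sup_adherent r0 PS.
have tT : t <= T by apply: sup_ubound => //; exact: PS.2.
have Teb : T = b.
  apply/eqP; rewrite eq_le Tb leNgt; apply/negP => Tltb.
  pose w := Num.min b (T + r / 2).
  have Pw : P w.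
    apply: (step t) => //; rewrite /w ?ge_min ?lexx// ?le_min ?(ltW Tltb) ?gt_min/=.
      by lra.
    by apply/orP; right; lra.
  have : w <= T by apply: sup_ubound => //; exact: PS.2.
  by rewrite /w ge_min => /orP[|]; lra.
have [_ _ [n [u [v [uv disj Fb]]]]] : P b by apply: (step t) => //; lra.
apply: (le_trans Fb); rewrite lerD2l; apply/ltW.
have tI : trivIset setT (fun i : 'I_n => `]u i, v i[%classic).
  apply/trivIsetP => i j _ _; wlog ij : i j / (i < j)%N.
    move=> h; rewrite neq_ltn => /orP[ij|ij]; first by apply: h => //; rewrite -val_eqE/= ltn_eqF.
    by rewrite setIC; apply: h => //; rewrite -val_eqE/= ltn_eqF.
  move=> _; apply/seteqP; split => // s [/=]; rewrite !in_itv/= => /andP[_ sv] /andP[us _].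
  by have := disj i j; rewrite ij ltn_ord => /(_ isT); lra.
apply: dF => //; first by move=> i; have [? ? ? _] := uv i (ltn_ord i); split.
rewrite -lte_fin; apply: le_lt_trans Ud.
rewrite -sumEFin (eq_bigr (fun i : 'I_n => mu `]u i, v i[%classic)); last first.
  move=> i _; rewrite lebesgue_measure_itv/= lte_fin.
  have [_ + _ _] := uv i (ltn_ord i); rewrite le_eqVlt => /predU1P[->|->//].
  by rewrite ltxx subrr.
rewrite -(@measure_bigsetU_ord _ _ _ mu n xpredT)//.
apply: le_measure; rewrite ?inE//.
- exact: bigsetU_measurable.
- exact: open_measurable.
- apply: (big_ind (fun X => X `<=` U)) => [//|X Y XU YU|i _].
    by rewrite subUset.
  by have [] := uv i (ltn_ord i).
Qed.

Lemma abs_continuousB (F G : R -> R^o) (a b : R) :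
  abs_continuous F a b -> abs_continuous G a b ->
  abs_continuous (fun t => F t - G t : R^o) a b.
Proof.
move=> acF acG e e0; have e20 : 0 < e / 2 by rewrite divr_gt0.
have [d d0 dF] := acF _ e20; have [r r0 rG] := acG _ e20.
exists (Num.min d r); first by rewrite lt_min d0.
move=> n u v uv tI; rewrite lt_min => /andP[/(dF n u v uv tI) Fd /(rG n u v uv tI) Gr].
apply: (@le_lt_trans _ _ (\sum_(i < n) (`|F (v i) - F (u i)| + `|G (v i) - G (u i)|))).
  apply: ler_sum => i _; apply: le_trans (ler_normB _ _).
  by rewrite le_eqVlt; apply/orP; left; apply/eqP; congr (`| _ |); ring.
by rewrite big_split/= [e]splitr ltrD.
Qed.

(** The increments over disjoint intervals add up to at most the integral of
[|q|] over their union, which is small with the measure of the union. *)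
Lemma abs_continuous_Rintegral (q : R -> R) (a b : R) :
  mu.-integrable setT (EFin \o q) ->
  abs_continuous (fun t => \int[mu]_(s in `[a, t]) q s : R^o) a b.
Proof.
move=> iq e e0; have [d [d0 dq]] := integral_normr_continuous iq e0.
exists d => // n u v uv tI sd.
have iqS (A : set R) : measurable A -> mu.-integrable A (EFin \o q).
  by move=> mA; apply: integrableS iq.
have mU : measurable (\big[setU/set0]_(i < n) `]u i, v i[%classic : set R).
  exact: bigsetU_measurable.
apply: (le_lt_trans _ (dq (\big[setU/set0]_(i < n) `]u i, v i[%classic) mU _)); last first.
  rewrite (@measure_bigsetU_ord _ _ _ mu n xpredT)//.
  rewrite (eq_bigr (fun i : 'I_n => (v i - u i)%:E)) ?sumEFin ?lte_fin//.
  move=> i _; rewrite [LHS]lebesgue_measure_itv/= lte_fin.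
  have [_ [+ _]] := uv i; rewrite le_eqVlt => /predU1P[->|->//].
  by rewrite ltxx subrr.
rewrite /Rintegral.
have mabs (A : set R) : measurable A -> measurable_fun A (fun x => `|q x|%:E).
  move=> mA; have /measurable_int/measurable_EFinP mq := iqS _ mA.
  by apply/measurable_EFinP; exact: measurableT_comp.
rewrite ge0_integral_bigsetU//; last 3 first.
- by rewrite index_enum_uniq.
- exact: sub_trivIset tI.
- exact: mabs.
rewrite -sum_fine; last first.
  move=> i _; apply: integrable_fin_num => //.
  by have /integrable_norm := iqS _ (measurable_itv `]u i, v i[).
apply: ler_sum => i _.
have [au [uv' vb]] := uv i.
rewrite (@Rintegral_itvB _ _ (BLeft a) (BRight (v i)))//; last exact: iqS.
apply: (le_trans (le_normr_Rintegral _ _)) => //; first exact: iqS.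
rewrite -Rintegral_itv_bndo_bndc//.
by have /integrable_norm := iqS _ (measurable_itv `]u i, v i[).
Qed.

(** Subtracting the indefinite integral of [q], whose derivative is [q] almost
everywhere, reduces to a function with nonpositive derivative. *)
Lemma abs_continuous_le_Rintegral (f q : R -> R) (a b : R) :
  a <= b -> abs_continuous (f : R -> R^o) a b ->
  mu.-integrable `[a, b] (EFin \o q) ->
  {ae mu, forall t, a < t < b -> derivable f t 1 /\ f^`()%classic t <= q t} ->
  f b - f a <= \int[mu]_(t in `[a, b]) q t.
Proof.
move=> ab acf iq df.
pose q0 := q \_ `[a, b].
have iq0 : mu.-integrable setT (EFin \o q0).
  by move: iq; rewrite integrable_mkcond//= restrict_EFin.
pose Q t := \int[mu]_(s in `[a, t]) q0 s.
have lq0 : locally_integrable setT q0.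
  by apply: open_integrable_locally => //; exact: openT.
have iq0y y : mu.-integrable [set` Interval (BLeft a) (BRight y)] (EFin \o q0).
  exact: integrableS iq0.
have dQ : {ae mu, forall t, a < t -> derivable Q t 1 /\ Q^`()%classic t = q0 t}.
  have := FTC1 iq0y lq0; apply: filterS => [|t Qt at_].
    exact: (ae_filter_ringOfSetsType mu).
  by apply: Qt; rewrite lte_fin.
pose N := ~` [set t | a < t < b -> derivable f t 1 /\ f^`()%classic t <= q t] `|`
          ~` [set t | a < t -> derivable Q t 1 /\ Q^`()%classic t = q0 t] `|`
          [set a] `|` [set b].
have : f b - Q b <= f a - Q a.
  apply: (@abs_continuous_small_increment_le (fun t => f t - Q t) a b N) => //.
  - exact: (abs_continuousB f Q a b acf (abs_continuous_Rintegral q0 a b iq0)).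
  - rewrite /N; do 2![apply: negligibleU; last first;
      first by apply/negligibleP => //; exact: lebesgue_measure_set1].
    exact: (negligibleU df dQ).
  - move=> t /andP[at_ tb] Nt.
    have tab : a < t < b.
      rewrite !lt_neqAle at_ tb !andbT; apply/andP; split; apply/eqP => tE; apply: Nt.
        by left; right; rewrite tE.
      by right; rewrite -tE.
    have [ft f't] : derivable f t 1 /\ f^`()%classic t <= q t.
      apply: contrapT => h; apply: Nt; left; left; left => /= /(_ tab); exact: h.
    have [Qt Q't] : derivable Q t 1 /\ Q^`()%classic t = q0 t.
      apply: contrapT => h; apply: Nt; left; left; right => /= h'; by apply/h/h'; case/andP: tab.
    apply: derivable_small_increment; first exact: derivableB.
    rewrite derive1E deriveB// -!derive1E Q't /q0 patchE mem_set/= ?in_itv/= ?at_//.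
    by rewrite subr_le0.
have -> : Q a = 0 by rewrite /Q set_itv1 Rintegral_set1.
suff -> : \int[mu]_(t in `[a, b]) q t = Q b by lra.
by apply: eq_Rintegral => t tab; rewrite /q0 patchE tab.
Qed.

End absolutely_continuous_functions.

(** * Bochner integrals of absolutely continuous curves *)

Section bochner.
Context {R : realType} {H : completeNormedModType R}.
Local Notation mu := (@lebesgue_measure R).
Variable ip : {dot H for idfun}.
Hypothesis ip_norm : forall x : H, ip x x = `|x| ^+ 2.

(** The integral of any nonnegative function is a supremum over the simple
functions below it, hence monotone. This form serves for the distance from a
vector-valued function to a step function, whose measurability would require a
separate argument. *)
Lemma le_integral_nonmeasurable (D : set R) (f g : R -> \bar R) :
  (forall r, D r -> (0 <= f r)%E) -> (forall r, D r -> (f r <= g r)%E) ->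
  (\int[mu]_(r in D) f r <= \int[mu]_(r in D) g r)%E.
Proof.
move=> f0 fg; rewrite !ge0_integralE//; last first.
  by move=> r Dr; exact: le_trans (f0 r Dr) (fg r Dr).
apply: le_ereal_sup => _ [h hf <-]; exists h => // r; apply: le_trans (hf r) _.
by rewrite /patch; case: ifPn => // /[!inE]; exact: fg.
Qed.

Lemma Rintegral_step (D : set R) (E : nat -> set R) (a : nat -> R) k :
  measurable D ->
  (forall i, [/\ measurable (E i), E i `<=` D & (mu (E i) < +oo)%E]) ->
  mu.-integrable D (EFin \o (fun r => \sum_(i < k) (\1_(E i) r * a i))) /\
  \int[mu]_(r in D) (\sum_(i < k) (\1_(E i) r * a i)) =
  \sum_(i < k) fine (mu (E i)) * a i.
Proof.
move=> mD mE.
have iE i : mu.-integrable D (EFin \o (\1_(E i) : R -> R)).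
  have [mEi EiD Eioo] := mE i.
  apply/integrableP; split; first by apply/measurable_EFinP; exact: measurable_indic.
  under eq_integral do rewrite /= ger0_norm//.
  by rewrite integral_indic// setIidl.
have iEa i : mu.-integrable D (EFin \o (fun r => \1_(E i) r * a i)).
  have := @integrableZr _ _ _ mu D mD (a i) _ (iE i); apply: eq_integrable => //.
elim: k => [|k [ihI ihE]].
  split.
    by apply: eq_integrable (@integrable0 _ _ _ mu D) => // r _; rewrite /= big_ord0.
  by under eq_Rintegral do rewrite big_ord0; rewrite Rintegral_cst// mul0r big_ord0.
have eS : (fun r => \sum_(i < k.+1) (\1_(E i) r * a i)) =
    (fun r => \sum_(i < k) (\1_(E i) r * a i) + \1_(E k) r * a k).
  by apply/funext => r; rewrite big_ord_recr.
rewrite eS; split; first exact: (@integrableD _ _ _ mu D mD _ _ ihI (iEa k)).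
rewrite RintegralD// ihE big_ord_recr/=; congr (_ + _).
rewrite RintegralZr//; congr (_ * _).
have [mEk EkD Ekoo] := mE k.
by rewrite /Rintegral integral_indic// setIidl.
Qed.

(** By Cauchy-Schwarz, convergence of the step functions in the L1 norm implies
convergence of the integrals of their pairings with [y]. *)
Lemma bochner_integral_ip (D : set R) (f : R -> H) (v y : H) :
  measurable D -> mu.-integrable D (EFin \o (fun r => ip (f r) y)) ->
  is_bochner_integral D f v -> ip v y = \int[mu]_(r in D) ip (f r) y.
Proof.
move=> mD ify [k [E [c]]]; set s := fun m r => _ => -[mE _ L1 sv].
have se m r : ip (s m r) y = \sum_(i < k m) (\1_(E m i) r * ip (c m i) y).
  by rewrite /s ip_suml; apply: eq_bigr => i _; rewrite ipZl.
pose S m := \sum_(i < k m) fine (mu (E m i)) *: c m i.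
have Se m : ip (S m) y = \sum_(i < k m) fine (mu (E m i)) * ip (c m i) y.
  by rewrite /S ip_suml; apply: eq_bigr => i _; rewrite ipZl.
have [sI sS] : (forall m, mu.-integrable D (EFin \o (fun r => ip (s m r) y))) /\
    (forall m, \int[mu]_(r in D) ip (s m r) y = ip (S m) y).
  split=> m; [under eq_fun do rewrite se|under eq_Rintegral do rewrite se].
    by have [] := Rintegral_step D (E m) (fun i => ip (c m i) y) (k m) mD (mE m).
  rewrite Se.
  by have [_] := Rintegral_step D (E m) (fun i => ip (c m i) y) (k m) mD (mE m).
have lim1 : ip (S m) y @[m --> \oo] --> ip v y.
  by apply: (cvg_comp S (ip^~ y)) sv _; exact: ip_continuousl.
suff lim2 : ip (S m) y @[m --> \oo] --> \int[mu]_(r in D) ip (f r) y.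
  exact: cvg_unique lim1 lim2.
set K : R := `|y| + 1; have K0 : 0 < K by rewrite ltr_wpDl.
have bound m : (`|ip (S m) y - \int[mu]_(r in D) ip (f r) y|%:E <=
    K%:E * \int[mu]_(r in D) `|f r - s m r|%:E)%E.
  have iB : mu.-integrable D (EFin \o (fun r => ip (s m r) y - ip (f r) y)).
    exact: (@integrableB _ _ _ mu D mD _ _ (sI m) ify).
  rewrite -sS -RintegralB// EFin_normr_Rintegral//.
  have [mB _] := integrableP _ _ _ iB.
  rewrite (le_trans (le_abse_integral _ _ _))//.
  rewrite -lee_pdivrMl//.
  rewrite -ge0_integralZl_EFin//; last by rewrite invr_ge0 ltW.
    apply: le_integral_nonmeasurable => r Dr.
      by rewrite mule_ge0// lee_fin invr_ge0 ltW.
    rewrite /= -EFinM lee_fin mulrC ler_pdivrMr// -ipBl.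
    rewrite (le_trans (cauchy_schwarz ip ip_norm _ _))// distrC ler_wpM2l//.
    by rewrite /K lerDl.
  exact: measurableT_comp.
apply/cvgrPdist_lt => e e0.
have eK : 0 < e / K by rewrite divr_gt0.
have /fine_cvgP[fin_a /cvgrPdist_lt/(_ _ eK) a_lt] := L1.
near=> m.
have am : (\int[mu]_(r in D) `|f r - s m r|%:E)%E \is a fin_num by near: m.
have := bound m; rewrite -(fineK am) -EFinM lee_fin distrC => /le_lt_trans; apply.
rewrite mulrC -ltr_pdivlMr//.
have : `|0 - fine (\int[mu]_(r in D) `|f r - s m r|%:E)%E| < e / K by near: m.
by rewrite sub0r normrN => /(le_lt_trans (ler_norm _)).
Unshelve. all: by end_near. Qed.

Lemma abs_continuous_unif (f : R -> H) (t e : R) :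
  abs_continuous f 0 t -> 0 < e -> exists2 d, 0 < d &
    forall u v, 0 <= u <= t -> 0 <= v <= t -> `|v - u| < d -> `|f v - f u| < e.
Proof.
move=> acf e0; have [d d0 df] := acf e e0; exists d => // u v.
wlog uv : u v / u <= v.
  move=> h ut vt; have [uv|/ltW vu] := leP u v; first exact: h.
  by rewrite distrC (distrC (f v)); exact: h.
move=> /andP[u0 ut] /andP[v0 vt]; rewrite ger0_norm ?subr_ge0// => uvd.
have := df 1%N (fun=> u) (fun=> v); rewrite !big_ord_recl !big_ord0 !addr0; apply => //.
by move=> i j _ _; rewrite (ord1 i) (ord1 j).
Qed.

Lemma abs_continuous_within (f : R -> H) (t : R) :
  abs_continuous f 0 t -> {within `[0, t], continuous f}.
Proof.
move=> acf; apply/subspace_continuousP => r /=; rewrite in_itv/= => rt.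
apply/cvgrPdist_lt => e e0; have [d d0 df] := abs_continuous_unif f t e acf e0.
rewrite near_withinE; near=> s => /=; rewrite in_itv/= => st; apply: df => //.
Unshelve. all: by end_near. Qed.

Lemma integrable_ip (f : R -> H) (t : R) y : {within `[0, t], continuous f} ->
  mu.-integrable `[0, t] (EFin \o (fun r => ip (f r) y)).
Proof.
move=> cf; apply: continuous_compact_integrable; first exact: segment_compact.
move=> r; apply: (@continuous_comp (subspace `[0, t]) H R f (ip^~ y)); first exact: cf.
exact: ip_continuousl.
Qed.

(** A uniform subdivision of mesh [1 / (n + 1)] yields step functions converging
uniformly to [f]. Their integrals are compared with the Riesz representative [v]
of [y |-> \int <f, y>]: pairing the difference [w] with itself gives
[|w|^2 <= C e_n |w|], where [e_n] is the uniform error. *)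
Lemma bochner_integrable (f : R -> H) (t : R) : abs_continuous f 0 t ->
  exists v, is_bochner_integral `[0, t] f v.
Proof.
move=> acf; have cf := abs_continuous_within f t acf.
have mD : measurable (`[0, t]%classic : set R) by [].
set D := (`[0, t]%classic : set R) in mD *.
have fI y := integrable_ip f t y cf.
pose l y := \int[mu]_(r in D) ip (f r) y.
have nfI : mu.-integrable D (EFin \o (fun r => `|f r|)).
  apply: continuous_compact_integrable; first exact: segment_compact.
  move=> r; apply: (@continuous_comp (subspace D) H R f Num.norm); first exact: cf.
  exact: norm_continuous.
have [v vl] : exists v, forall y, ip v y = l y.
  apply: (riesz_representation ip ip_norm l (\int[mu]_(r in D) `|f r|)).
  - move=> y z; rewrite /l -RintegralD//; apply: eq_Rintegral => r _.
    by rewrite ipDr.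
  - move=> a y; rewrite /l -RintegralZl//; apply: eq_Rintegral => r _.
    by rewrite ipZr.
  - move=> y; rewrite (le_trans (le_normr_Rintegral _ (fI y)))//.
    rewrite -RintegralZr//; apply: le_Rintegral => //.
    + by have /integrable_norm := fI y.
    + by have := @integrableZr _ _ _ mu D mD `|y| _ nfI; apply: eq_integrable.
    + by move=> r _; exact: cauchy_schwarz.
(* The last half-open interval reaches past [t] before being cut by [D]. *)
pose h n : R := n.+1%:R^-1.
pose E n i : set R := `[i%:R * h n, i.+1%:R * h n[%classic `&` D.
pose c n i := f (i%:R * h n).
pose k n := (Num.truncn (t * n.+1%:R)).+1.
pose s n r := \sum_(i < k n) (\1_(E n i) r : R) *: c n i.
have h0 n : 0 < h n by rewrite /h invr_gt0.
have sE n r : D r -> exists u, [/\ 0 <= u, u <= r, r - u < h n & s n r = f u].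
  rewrite /D/= in_itv/= => /andP[r0 rt].
  have rn0 : 0 <= r * n.+1%:R by rewrite mulr_ge0.
  pose i := Num.truncn (r * n.+1%:R).
  have Ei j : (\1_(E n j) r : R) = (j == i)%:R.
    rewrite indicE; congr (nat_of_bool _)%:R.
    rewrite eq_sym truncn_eq//; apply/idP/idP.
      rewrite inE => -[/=]; rewrite in_itv/= => /andP[+ +] _.
      by rewrite /h ler_pdivrMr// ltr_pdivlMr// => -> ->.
    move=> /andP[? ?]; rewrite inE; split; last by rewrite /D/= in_itv/= r0.
    rewrite /= in_itv/=.
    by rewrite /h ler_pdivrMr// ltr_pdivlMr//; apply/andP.
  have ik : (i < k n)%N.
    by rewrite /k ltnS le_truncn// ler_pM2r.
  have /andP[i1 i2] := truncn_itv rn0.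
  exists (i%:R * h n); split.
  - by rewrite mulr_ge0// ltW.
  - by rewrite /h ler_pdivrMr.
  - have : r < i.+1%:R * h n by rewrite /h ltr_pdivlMr.
    by rewrite -natr1 mulrDl mul1r ltrBlDr addrC.
  - rewrite /s (bigD1 (Ordinal ik))//= Ei eqxx scale1r big1 ?addr0// => j.
    by rewrite Ei -val_eqE/= => /negPf ->; rewrite scale0r.
have unif e : 0 < e -> \forall n \near \oo, forall r, D r -> `|f r - s n r| < e.
  move=> e0; have [d d0 df] := abs_continuous_unif f t e acf e0.
  have /cvgrPdist_lt/(_ _ d0) : h n @[n --> \oo] --> (0 : R) by exact: cvg_harmonic.
  apply: filterS => n; rewrite sub0r normrN gtr0_norm// => hd r Dr.
  have [u [u0 ur uh ->]] := sE n r Dr.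
  move: Dr; rewrite /D/= in_itv/= => /andP[r0 rt].
  apply: df; rewrite ?u0 ?r0 ?rt ?(le_trans ur)//.
  by rewrite ger0_norm ?subr_ge0//; exact: lt_trans uh hd.
have muD : mu D = (fine (mu D))%:E.
  by rewrite fineK// /D lebesgue_measure_itv/=; case: ifP.
have mE n i : [/\ measurable (E n i), E n i `<=` D & (mu (E n i) < +oo)%E].
  have mEi : measurable (E n i) by apply: measurableI.
  split => //; first by move=> r [].
  apply: (@le_lt_trans _ _ (mu D)); last by rewrite muD ltry.
  by apply: le_measure; rewrite ?inE//; move=> r [].
exists v, k, E, c; split.
- by move=> n i; exact: mE.
- apply: aeW => r Dr; apply/cvgrPdist_lt => e e0.
  by apply: filterS (unif e e0) => n; exact.
- have bound e : 0 < e -> \forall n \near \oo,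
      (\int[mu]_(r in D) `|f r - s n r|%:E <= (e * fine (mu D))%:E)%E.
    move=> e0; apply: filterS (unif e e0) => n fs.
    rewrite EFinM -muD -integral_cst//.
    by apply: le_integral_nonmeasurable => r Dr /=; rewrite lee_fin// ltW// fs.
  have ge0 n : (0 <= \int[mu]_(r in D) `|f r - s n r|%:E)%E.
    by apply: integral_ge0 => r _; rewrite lee_fin.
  apply/fine_cvgP; split.
    apply: filterS (bound 1 ltr01) => n fs.
    by rewrite ge0_fin_numE; [exact: le_lt_trans fs (ltry _)|exact: ge0].
  apply/cvgrPdist_lt => e e0.
  have m0 : 0 < fine (mu D) + 1 by rewrite ltr_wpDl// fine_ge0.
  have e1 : 0 < e / (fine (mu D) + 1) by rewrite divr_gt0.
  apply: filterS (bound _ e1) => n fs.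
  rewrite sub0r normrN ger0_norm; last exact/fine_ge0/ge0.
  have fin : (\int[mu]_(r in D) `|f r - s n r|%:E)%E \is a fin_num.
    by rewrite ge0_fin_numE// (le_lt_trans fs)// ltry.
  move: fs; rewrite -(fineK fin) lee_fin => /le_lt_trans; apply.
  by rewrite mulrAC ltr_pdivrMr// ltr_pM2l// ltrDl.
- apply/cvgrPdist_lt => e e0.
  have m0 : 0 < fine (mu D) + 1 by rewrite ltr_wpDl// fine_ge0.
  have e1 : 0 < e / (fine (mu D) + 1) by rewrite divr_gt0.
  apply: filterS (unif _ e1) => n fs.
  set w := _ - _.
  have [->|w0] := eqVneq w 0; first by rewrite normr0.
  have nw0 : 0 < `|w| by rewrite normr_gt0.
  have se r : ip (s n r) w = \sum_(i < k n) (\1_(E n i) r * ip (c n i) w).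
    by rewrite /s ip_suml; apply: eq_bigr => i _; rewrite ipZl.
  have [sI sS] := Rintegral_step D (E n) (fun i => ip (c n i) w) (k n) mD (mE n).
  have wE : `|w| ^+ 2 = \int[mu]_(r in D) (ip (f r) w - \sum_(i < k n) (\1_(E n i) r * ip (c n i) w)).
    rewrite RintegralB// sS -ip_norm {1}/w ipBl vl ip_suml; congr (_ - _).
    by apply: eq_bigr => i _; rewrite ipZl.
  have : `|w| ^+ 2 <= (e / (fine (mu D) + 1) * `|w|) * fine (mu D).
    rewrite wE -Rintegral_cst//; apply: le_Rintegral => //.
    - exact: (@integrableB _ _ _ mu D mD _ _ (fI w) sI).
    - apply: continuous_compact_integrable; first exact: segment_compact.
      by move=> r; exact: cvg_cst.
    - move=> r Dr; rewrite -se -ipBl; apply: le_trans (ler_norm _) _.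
      by rewrite (le_trans (cauchy_schwarz ip ip_norm _ _))// ler_wpM2r// ltW// fs.
  rewrite expr2 mulrAC ler_pM2r// => /le_lt_trans; apply.
  by rewrite mulrAC ltr_pdivrMr// ltr_pM2l// ltrDl.
Qed.

(** The only property of the Bochner integral of the trajectory that the
asymptotic analysis relies on. *)
Lemma ip_bochner_integral (f : R -> H) (t : R) y : abs_continuous f 0 t ->
  ip (bochner_integral `[0, t] f) y = \int[mu]_(r in `[0, t]) ip (f r) y.
Proof.
move=> acf; apply: bochner_integral_ip => //.
  exact/integrable_ip/abs_continuous_within.
by apply: xgetPex; exact: bochner_integrable.
Qed.

End bochner.

(** * Weak limits along ultrafilters *)

Section ultrafilters.

Lemma ultra_fmap (T U : Type) (f : T -> U) (F : set_system T) :
  UltraFilter F -> UltraFilter (f @ F).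
Proof.
move=> FU; split; first exact: fmap_proper_filter.
move=> G GF FG; rewrite predeqE => B; split; last exact: FG.
move=> GB; have [//|FnB] := in_ultra_setVsetC (f @^-1` B) FU.
have GnB : G (~` B) by exact: FG.
by have [? []] := filter_ex (filterI GB GnB).
Qed.

(** If the preimage of a neighbourhood of [l] is not in [F], then its complement
meets every member of [F], and some ultrafilter finer than [F] contains it. *)
Lemma cvg_ultra (T : Type) (U : topologicalType) (f : T -> U) (F : set_system T) (l : U) :
  Filter F ->
  (forall G : set_system T, UltraFilter G -> F `<=` G -> f @ G --> l) -> f @ F --> l.
Proof.
move=> FF fG B lB; apply: contrapT => nFB.
have WF : ProperFilter (within (~` (f @^-1` B)) F).
  apply: Build_ProperFilter => // W; apply: nFB.
  rewrite /fmap /=; move: W; rewrite /within /=; apply: filterS => t /= nB.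
  exact: contrapT.
have [G [GU WG]] := ultraFilterLemma WF.
have FG : F `<=` G.
  by move=> D FD; apply: WG; rewrite /within/=; apply: filterS FD.
have GB : G (f @^-1` B) by exact: (fG G GU FG).
have GnB : G (~` (f @^-1` B)) by apply: WG; rewrite /within/=; apply: nearW.
by have [? []] := filter_ex (filterI GB GnB).
Qed.

Lemma bounded_ultra_cvg {R : realType} (T : Type) (f : T -> R) (G : set_system T) (M : R) :
  UltraFilter G -> (\forall t \near G, `|f t| <= M) -> cvg (f @ G).
Proof.
move=> GU fM; have fU := ultra_fmap _ _ f G GU.
have := @segment_compact R (- M) M; rewrite compact_ultra => /(_ (f @ G) fU) [|p [_ fp]].
  by apply: filterS fM => t; rewrite /= in_itv/= ler_norml.
by apply/cvg_ex; exists p.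
Qed.

End ultrafilters.

Section weak_convergence.
Context {R : realType} {H : completeNormedModType R}.
Variable ip : {dot H for idfun}.
Hypothesis ip_norm : forall x : H, ip x x = `|x| ^+ 2.

(** Weak compactness of balls: the limits of the real functions
[ip (X t) y] along an ultrafilter depend linearly and boundedly on [y]. *)
Lemma bounded_ultra_weakly_cvg (X : R -> H) (G : set_system R) (M : R) :
  UltraFilter G -> (\forall t \near G, `|X t| <= M) ->
  exists v, weakly_cvg ip X G v.
Proof.
move=> GU XM.
have ipM y : \forall t \near G, `|ip (X t) y| <= M * `|y|.
  apply: filterS XM => t tM; apply: le_trans (cauchy_schwarz ip ip_norm _ _) _.
  by rewrite ler_wpM2r.
pose l y := lim (ip (X t) y @[t --> G]).
have ly y : ip (X t) y @[t --> G] --> l y.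
  exact: (bounded_ultra_cvg _ (fun t => ip (X t) y) G (M * `|y|) GU (ipM y)).
have [v vl] : exists v, forall y, ip v y = l y.
  apply: (riesz_representation ip ip_norm l M).
  - move=> y z; apply: cvg_lim => //.
    by under eq_cvg do rewrite ipDr; exact: cvgD.
  - move=> a y; apply: cvg_lim => //.
    by under eq_cvg do rewrite ipZr; apply: cvgM => //; exact: cvg_cst.
  - move=> y; have := cvg_norm (ly y) => lny.
    exact: (cvgr_to_le (lny _) (ipM y)).
by exists v => y; rewrite vl.
Qed.

(** Two cluster points [v] and [w] pair identically with [v - w], because
[<X t, v - w>] has a single limit; so [|v - w|^2 = 0], and all ultrafilters at
infinity see the same weak limit. *)
Lemma opial (X : R -> H) (S : set H) (M : R) :
  (\forall t \near +oo, `|X t| <= M) ->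
  (forall G v, UltraFilter G -> pinfty_nbhs R `<=` G -> weakly_cvg ip X G v -> S v) ->
  (forall v w, S v -> S w -> cvg (ip (X t) (v - w) @[t --> +oo])) ->
  exists2 v, S v & weakly_cvg ip X +oo v.
Proof.
move=> XM XS Xcvg.
have [G [GU oG]] := ultraFilterLemma (@proper_pinfty_nbhs R).
have [v vG] := bounded_ultra_weakly_cvg X G M GU (oG _ XM).
exists v => [|y]; first exact: XS vG.
apply: cvg_ultra => G' G'U oG'.
have [w wG] := bounded_ultra_weakly_cvg X G' M G'U (oG' _ XM).
suff -> : v = w by exact: wG.
have /cvg_ex[/= c Xc] := Xcvg v w (XS G v GU oG vG) (XS G' w G'U oG' wG).
have vc : ip v (v - w) = c.
  by apply: cvg_unique (vG (v - w)) _ => //; apply: cvg_trans Xc; exact: cvg_app.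
have wc : ip w (v - w) = c.
  by apply: cvg_unique (wG (v - w)) _ => //; apply: cvg_trans Xc; exact: cvg_app.
apply/eqP; rewrite -subr_eq0 -normr_eq0 -sqrf_eq0 -ip_norm ipBl vc wc.
by rewrite subrr.
Qed.

End weak_convergence.

(** * Limits and integrals at infinity *)

Lemma nondecreasing_bounded_cvg {R : realType} (F : R -> R) (M : R) :
  (forall s t, 0 <= s -> s <= t -> F s <= F t) -> (forall t, 0 <= t -> F t <= M) ->
  cvg (F t @[t --> +oo]).
Proof.
(* [F] is monotone on [0, +oo[ only; its values elsewhere are replaced by [F 0]. *)
move=> ndF FM; pose F' t := F (Num.max t 0).
apply/cvg_ex; exists (sup (range F')).
have : F' t @[t --> +oo] --> sup (range F').
  apply: nondecreasing_cvgr.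
    move=> s t st; apply: ndF; first by rewrite le_max lexx orbT.
    by rewrite ge_max !le_max st lexx !orbT.
  by exists M => _ [t _ <-]; apply: FM; rewrite le_max lexx orbT.
apply: cvg_trans; apply: near_eq_cvg.
by exists 0; split => // t /ltW t0; rewrite /F' max_l.
Qed.

Lemma Rintegral_cst_itv {R : realType} (c t : R) : 0 <= t ->
  \int[@lebesgue_measure R]_(r in `[0, t]) c = c * t.
Proof.
move=> t0; rewrite Rintegral_cst//; congr (_ * _).
rewrite [X in fine X]lebesgue_measure_itv/= lte_fin.
case: ltP => [_|t0']; first by rewrite sube0.
by apply: le_anti; apply/andP; split.
Qed.

Lemma cvg_inv_pinfty {R : realType} : t^-1 @[t --> +oo] --> (0 : R).
Proof.
apply: (proj2 (@gtr0_cvgV0 R R (pinfty_nbhs R) _ id _)); last exact: cvg_id.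
by apply: nbhs_pinfty_gt; rewrite num_real.
Qed.

(** Past some [b] the integrand is within [e / 2] of [l], and the contribution of
[0, b] is a constant, negligible against [t]. *)
Lemma cesaro_mean_cvg {R : realType} (f : R -> R) (l : R) :
  (forall t, (@lebesgue_measure R).-integrable `[0, t] (EFin \o f)) ->
  f t @[t --> +oo] --> l ->
  t^-1 * \int[@lebesgue_measure R]_(s in `[0, t]) f s @[t --> +oo] --> l.
Proof.
move=> fi fl; apply/cvgrPdist_le => e e0.
have e20 : 0 < e / 2 by rewrite divr_gt0.
have /cvgrPdist_le/(_ _ e20)[a [_ fa]] := fl.
pose b := Num.max a 0 + 1.
have b0 : 0 < b by rewrite ltr_wpDl// le_max lexx orbT.
have fb r : b <= r -> `|f r - l| <= e / 2.
  move=> br; rewrite distrC; apply: fa; apply: lt_le_trans br.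
  by rewrite /b; apply: (@le_lt_trans _ _ (Num.max a 0)); rewrite ?ltrDl// le_max lexx.
have arith K' T t : 2 * K' <= t * e -> T <= e / 2 * (t - b) -> K' + T <= e * t.
  by move=> ? ?; nra.
pose F t := \int[@lebesgue_measure R]_(s in `[0, t]) f s.
near=> t.
have bt : b <= t by near: t; apply: nbhs_pinfty_ge; rewrite num_real.
have t0 : 0 < t by exact: lt_le_trans bt.
have Kt : 2 * `|F b - b * l| / e <= t by near: t; apply: nbhs_pinfty_ge; rewrite num_real.
have Fbt : F t = F b + \int[@lebesgue_measure R]_(s in `]b, t]) f s.
  by rewrite -(@Rintegral_itvB _ f (BLeft 0) (BRight t) b)//= ?bnd_simp ?(ltW b0)// addrC subrK.
have mu_bt : fine (@lebesgue_measure R `]b, t]) = t - b.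
  by rewrite lebesgue_measure_itv/= lte_fin; case: ltP => // tb; apply/eqP; rewrite eq_sym subr_eq0 eq_le tb bt.
have ifbt : (@lebesgue_measure R).-integrable `]b, t] (EFin \o f).
  apply: integrableS (fi t) => // r /=; rewrite !in_itv/= => /andP[br ->].
  by rewrite (le_trans (ltW b0))// ltW.
have cst_i c : (@lebesgue_measure R).-integrable `]b, t] (EFin \o cst c).
  apply: (@integrableS _ _ _ (@lebesgue_measure R) `[b, t]%classic) => //; first exact: subset_itv_oc_cc.
  apply: continuous_compact_integrable; first exact: segment_compact.
  by move=> r; exact: cvg_cst.
have ifl : (@lebesgue_measure R).-integrable `]b, t] (EFin \o (fun s => f s - l)).
  exact: (@integrableB _ _ _ (@lebesgue_measure R) `]b, t]%classic (measurable_itv _) _ _ ifbt (cst_i l)).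
have tail : `|\int[@lebesgue_measure R]_(s in `]b, t]) f s - (t - b) * l| <= e / 2 * (t - b).
  have -> : (t - b) * l = \int[@lebesgue_measure R]_(s in `]b, t]) l.
    by rewrite Rintegral_cst// mu_bt mulrC.
  rewrite -RintegralB//; last exact: cst_i.
  apply: le_trans (le_normr_Rintegral _ ifl) _ => //.
  rewrite -mu_bt -Rintegral_cst//; apply: le_Rintegral => //.
  - exact: (integrable_norm ifl).
  - exact: cst_i.
  - by move=> r /=; rewrite in_itv/= => /andP[/ltW br _]; exact: fb.
have -> : l - t^-1 * F t = - (t^-1 * ((F b - b * l) + (F t - F b - (t - b) * l))).
  by field; rewrite gt_eqF.
rewrite normrN normrM ger0_norm ?invr_ge0 ?(ltW t0)// mulrC ler_pdivrMr//.
have -> : F t - F b = \int[@lebesgue_measure R]_(s in `]b, t]) f s by rewrite Fbt addrC addKr.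
apply: le_trans (ler_normD _ _) _.
by move: Kt; rewrite ler_pdivrMr// => Kt; exact: arith.
Unshelve. all: by end_near. Qed.

(** * The distance to a point and the Fenchel gap *)

Section squared_distance.
Context {R : realType} {H : completeNormedModType R}.
Variable ip : {dot H for idfun}.
Hypothesis ip_norm : forall x : H, ip x x = `|x| ^+ 2.

Lemma derive_half_sqr_dist (x : R -> H) (z : H) (t : R) :
  derivable x t 1 ->
  derivable (fun s => `|x s - z| ^+ 2 / 2) t 1 /\
  (fun s => `|x s - z| ^+ 2 / 2)^`()%classic t = ip (x^`()%classic t) (x t - z).
Proof.
move=> dx; set h := fun s => _.
pose d s := s^-1 *: (x (s + t) - x t).
have dl : d s @[s --> 0^'] --> x^`()%classic t.
  have := dx; rewrite /derivable /derive1 => /cvg_ex[l /= xl].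
  have dl : d s @[s --> 0^'] --> l.
    by apply: cvg_trans xl; apply: near_eq_cvg; near=> s; rewrite /= [s *: _]mulr1.
  by rewrite (cvg_lim _ dl).
have hl : s^-1 * (h (s + t) - h t) @[s --> 0^'] -->
    ip (x^`()%classic t) (x t - z).
  have lim : ip (d s) (x t - z) + s * (`|d s| ^+ 2 / 2) @[s --> 0^'] -->
      ip (x^`()%classic t) (x t - z) + 0 * (`|x^`()%classic t| ^+ 2 / 2).
    apply: cvgD; first by apply: (cvg_comp d (ip^~ _) dl); exact: ip_continuousl.
    apply: cvgM; first exact: cvg_within.
    apply: cvgM; last exact: cvg_cst.
    rewrite expr2; under eq_cvg do rewrite expr2.
    by apply: cvgM; exact: cvg_norm.
  rewrite mul0r addr0 in lim; apply: cvg_trans lim; apply: near_eq_cvg.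
  near=> s.
  have s0 : s != 0 by near: s; exact: nbhs_dnbhs_neq.
  have xs : x (s + t) - z = s *: d s + (x t - z).
    by rewrite /d scalerA mulfV// scale1r addrA subrK.
  move: (d s) xs => ds xs; rewrite /h xs (sqr_normD ip ip_norm) ipZl normrZ exprMn.
  by rewrite real_normK ?num_real//; field.
split; first by apply/cvg_ex; eexists; move: hl; apply: cvg_trans;
  apply: near_eq_cvg; near=> s; rewrite /= [s *: _]mulr1.
by rewrite /derive1; apply: cvg_lim.
Unshelve. all: by end_near. Qed.

Lemma abs_continuous_half_sqr_dist (x : R -> H) (z : H) (T : R) : 0 <= T ->
  abs_continuous x 0 T ->
  abs_continuous (fun s => `|x s - z| ^+ 2 / 2 : R^o) 0 T.
Proof.
move=> T0 acx; have cx := abs_continuous_within x T acx.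
have [c _ cmax] : exists2 c, c \in `[0, T] & forall t, t \in `[0, T] -> `|x t - z| <= `|x c - z|.
  apply: EVT_max => // r.
  apply: (@continuous_comp (subspace `[0, T]) H R (fun s => x s - z) Num.norm).
    by apply: cvgB; [exact: cx|exact: cvg_cst].
  exact: norm_continuous.
have B0 : 0 < `|x c - z| + 1 by rewrite ltr_wpDl.
set B := `|x c - z| in cmax B0 *.
move=> e e0; have [d d0 dx] := acx _ (divr_gt0 e0 B0).
exists d => // n u v uv tI /(dx n u v uv tI).
rewrite ltr_pdivlMr// => /(le_lt_trans _); apply.
rewrite big_distrl/=; apply: ler_sum => i _.
have [u0 [uvi vT]] := uv i.
have uB : `|x (u i) - z| <= B by apply: cmax; rewrite in_itv/= u0 (le_trans uvi).
have vB : `|x (v i) - z| <= B by apply: cmax; rewrite in_itv/= (le_trans u0).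
have xd : `| `|x (v i) - z| - `|x (u i) - z| | <= `|x (v i) - x (u i)|.
  by apply: le_trans (ler_dist_dist _ _) _; rewrite opprB addrA subrK.
rewrite -mulrBl subr_sqr normrM (ger0_norm (_ : 0 <= 2^-1))// normrM.
rewrite [X in _ * X * _]ger0_norm ?addr_ge0// -mulrA.
by apply: ler_pM => //; lra.
Qed.

End squared_distance.

Section fenchel_gap.
Context {R : realType} {H : completeNormedModType R}.
Variable ip : {dot H for idfun}.
Variable Psi : H -> \bar R.
Hypothesis Psi_ge0 : forall x, (0 <= Psi x)%E.
Implicit Types (p z : H) (b : R).

(** For [b > 0] and [p] normal at [z] this is [b (Psi^*(p / b) - sigma_C(p / b))],
see [fenchel_gapE]. Written as a supremum of affine functions of [b] it is
visibly lower semicontinuous in [b]; restricting to the domain of [Psi] keeps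
every term real for all signs of [b]. *)
Definition fenchel_gap p z b : \bar R :=
  ereal_sup [set (ip p (x - z) - b * fine (Psi x))%:E | x in [set x | (Psi x < +oo)%E]].

Lemma le_fenchel_gap p z b x r : Psi x = r%:E ->
  ((ip p (x - z) - b * r)%:E <= fenchel_gap p z b)%E.
Proof.
by move=> xr; apply: ereal_sup_ubound; exists x; rewrite /= xr ?ltry.
Qed.

Lemma fenchel_gap_ge0 p z b : Psi z = 0%E -> (0 <= fenchel_gap p z b)%E.
Proof.
move=> z0; have := le_fenchel_gap p z b z 0 z0.
by rewrite subrr (ipC ip) (ip0l ip) mulr0 subrr.
Qed.

Lemma measurable_fenchel_gap p z : measurable_fun setT (fenchel_gap p z).
Proof.
apply: lower_semicontinuous_measurable => b a /ereal_sup_gt[_ [x /= xoo <-]].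
rewrite lte_fin => ab.
exists [set b' | a < ip p (x - z) - b' * fine (Psi x)].
  have : ip p (x - z) - b' * fine (Psi x) @[b' --> b] --> ip p (x - z) - b * fine (Psi x).
    by apply: cvgB; [exact: cvg_cst|apply: cvgM; [exact: cvg_id|exact: cvg_cst]].
  by move=> /cvgr_gt/(_ _ ab).
move=> b' /= ab'; apply: (@lt_le_trans _ _ (ip p (x - z) - b' * fine (Psi x))%:E).
  by rewrite lte_fin.
by apply: le_fenchel_gap; rewrite fineK// ge0_fin_numE.
Qed.

(** On the ray through a normal at [z] the support function is attained at
[z]; multiplying through by [b] turns the conjugate into a supremum of functions
affine in [b]. *)
Lemma fenchel_gapE (C : set H) p z b : normal_cone ip C z p -> 0 < b ->
  (b%:E * (fenchel_conjugate ip Psi (b^-1 *: p) - support_function ip C (b^-1 *: p))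
   = fenchel_gap p z b)%E.
Proof.
move=> [Cz pz] b0; have bV0 : 0 < b^-1 by rewrite invr_gt0.
have bn0 : b != 0 by rewrite gt_eqF.
have -> : support_function ip C (b^-1 *: p) = (b^-1 * ip p z)%:E.
  apply/eqP; rewrite eq_le; apply/andP; split.
    apply: ge_ereal_sup => _ [y Cy <-]; rewrite lee_fin ipZl ler_pM2l//.
    by have := pz y Cy; rewrite ipBr subr_le0.
  by apply: ereal_sup_ubound; exists z => //; rewrite ipZl.
apply/eqP; rewrite eq_le; apply/andP; split.
  rewrite muleC -lee_pdivlMr// leeBlDr//.
  apply: ge_ereal_sup => _ [x _ <-].
  have [xoo|] := ltP (Psi x) +oo%E; last by rewrite leye_eq => /eqP ->; rewrite /= addeNy leNye.
  have xfin : Psi x \is a fin_num by rewrite ge0_fin_numE.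
  have := le_fenchel_gap p z b x (fine (Psi x)); rewrite fineK// => /(_ erefl) xg.
  rewrite -leeBlDr// lee_pdivlMr// -(fineK xfin) -!EFinB -EFinM.
  apply: le_trans xg; rewrite lee_fin le_eqVlt; apply/orP; left; apply/eqP.
  by rewrite ipZl ipBr; field.
apply: ge_ereal_sup => _ [x /= xoo <-].
have xfin : Psi x \is a fin_num by rewrite ge0_fin_numE.
rewrite muleC -lee_pdivrMr// EFinN leeBrDr//.
apply: (@le_trans _ _ ((ip (b^-1 *: p) x)%:E - Psi x)%E); last first.
  by apply: ereal_sup_ubound; exists x.
rewrite -(fineK xfin) -EFinM -EFinB -EFinD lee_fin le_eqVlt; apply/orP; left; apply/eqP.
by rewrite ipZl ipBr /=; field.
Qed.

End fenchel_gap.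

(** * The trajectory *)

Section trajectory.
Import HBNNSimple.
Context {R : realType} {H : completeNormedModType R}.
Local Notation mu := (@lebesgue_measure R).
Variable ip : {dot H for idfun}.
Hypothesis ip_norm : forall x : H, ip x x = `|x| ^+ 2.
Variables (A : H -> set H) (Psi : H -> \bar R) (beta : R -> R) (x : R -> H).
Hypothesis A_mono : monotone_op ip A.
Hypothesis Psi_ge0 : forall y, (0 <= Psi y)%E.
Hypothesis beta_meas : measurable_fun (`[0, +oo[%classic : set R) beta.
Hypothesis beta_gt0 : forall t, 0 <= t -> 0 < beta t.
Hypothesis x_sol : strong_solution ip A Psi beta x.

Definition energy z t : R := `|x t - z| ^+ 2 / 2.

Lemma energy_ge0 z t : 0 <= energy z t.
Proof. by rewrite /energy divr_ge0// sqr_ge0. Qed.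

Lemma solution_abs_continuous T : 0 <= T -> abs_continuous x 0 T.
Proof. by have [_ acx _] := x_sol; exact: acx. Qed.

(** Monotonicity of [A] compares the trajectory with the pair [(z, u)], and
the subgradient inequality is tested at the zero [z] of [Psi]. *)
Lemma energy_inequality z u : Psi z = 0%E -> A z u ->
  {ae mu, forall t, 0 < t -> exists r, [/\ Psi (x t) = r%:E,
    derivable (energy z) t 1
    & (energy z)^`()%classic t + beta t * r + ip u (x t - z) <= 0]}.
Proof.
move=> z0 Azu; have [_ _ [xi [eta xieta]]] := x_sol.
move: xieta; apply: filterS => [|t sol t0]; first exact: (ae_filter_ringOfSetsType mu).
have [Axi Peta dx eqx] := sol t0.
have [dh hE] := derive_half_sqr_dist ip ip_norm x z t dx.
have := Peta z; rewrite z0.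
have := Psi_ge0 (x t); case Px : (Psi (x t)) => [r| |] //= r0 rz.
exists r; split => //.
rewrite [X in X + _ + _]hE.
have -> : x^`()%classic t = - (xi t) - beta t *: eta t.
  by move/eqP: eqx; rewrite -addrA addr_eq0 opprD => /eqP.
have := A_mono _ _ _ _ Axi Azu; rewrite !ipBl ipNl ipZl.
move: rz; rewrite -EFinD lee_fin -(opprB (x t)) -(scaleN1r (x t - z)) ipZr.
have bt := beta_gt0 _ (ltW t0); nra.
Qed.

Section normal_direction.
Variables (C : set H) (z p : H).
Hypothesis Psi_z : Psi z = 0%E.
Hypothesis pz : normal_cone ip C z p.
Hypothesis gap_int : (\int[mu]_(t in `[0%R, +oo[)
   ((beta t)%:E * (fenchel_conjugate ip Psi ((beta t)^-1 *: p)
                   - support_function ip C ((beta t)^-1 *: p))) < +oo)%E.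

(** Taking [fine] replaces the value +oo, which only occurs on a null set. *)
Definition gap t : R := fine (fenchel_gap ip Psi p z (beta t)).

Lemma gap_ge0 t : 0 <= gap t.
Proof. by rewrite fine_ge0// fenchel_gap_ge0. Qed.

Let egap_integrable :
  mu.-integrable `[0, +oo[ (fun t => fenchel_gap ip Psi p z (beta t)).
Proof.
apply/integrableP; split.
  apply: measurableT_comp => //; exact: measurable_fenchel_gap.
move: gap_int; congr (is_true (_ < _)%E); apply: eq_integral => t.
rewrite inE/= in_itv/= andbT => t0.
by rewrite gee0_abs ?fenchel_gap_ge0// -(fenchel_gapE ip Psi Psi_ge0 C)// beta_gt0.
Qed.

Lemma gap_fin : {ae mu, forall t, 0 <= t ->
  fenchel_gap ip Psi p z (beta t) = (gap t)%:E}.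
Proof.
have mD : measurable (`[0, +oo[%classic : set R) by [].
have := @integrable_ae _ _ _ mu _ mD _ egap_integrable.
apply: filterS => t tfin t0.
by rewrite /gap fineK// tfin//= in_itv/= andbT.
Qed.

Lemma gap_integrable : mu.-integrable `[0, +oo[ (EFin \o gap).
Proof.
apply: (le_integrable _ _ _ egap_integrable) => //.
- apply/measurable_EFinP; apply: measurableT_comp => //.
  exact: (measurable_int _ egap_integrable).
- move=> t _; rewrite /= !gee0_abs ?lee_fin ?gap_ge0// ?fenchel_gap_ge0//.
  rewrite /gap; have := fenchel_gap_ge0 ip Psi p z (beta t) Psi_z.
  case: (fenchel_gap _ _ _ _ _) => [r|_|//]; last by rewrite /= normr0 leey.
  by rewrite lee_fin => r0; rewrite /= ger0_norm.
Qed.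

Lemma gap_integrable_itv s t : 0 <= s -> mu.-integrable `[s, t] (EFin \o gap).
Proof.
move=> s0; apply: integrableS gap_integrable => // r /=; rewrite !in_itv/= andbT.
by move=> /andP[sr _]; exact: le_trans sr.
Qed.

Lemma gap_le_total t : 0 <= t ->
  \int[mu]_(s in `[0, t]) gap s <= \int[mu]_(s in `[0, +oo[) gap s.
Proof.
move=> t0; have it := gap_integrable_itv 0 t (lexx _).
apply: fine_le; [exact: integrable_fin_num|exact: (integrable_fin_num _ gap_integrable)|].
apply: ge0_subset_integral => //; first exact: (measurable_int _ gap_integrable).
- by move=> s _; rewrite /= lee_fin gap_ge0.
- by move=> s /=; rewrite !in_itv/= andbT => /andP[].
Qed.

(** Young's inequality for [Psi] and its conjugate absorbs the normal [p]
into the penalty term, at the price of the gap. *)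
Lemma energy_growth u s t : A z u -> 0 <= s -> s <= t ->
  energy z t - energy z s + \int[mu]_(r in `[s, t]) ip (u + p) (x r - z)
  <= \int[mu]_(r in `[s, t]) gap r.
Proof.
move=> Azu s0 st; have t0 := le_trans s0 st.
have act := solution_abs_continuous t t0.
have ic : mu.-integrable `[s, t] (EFin \o (fun r => ip (u + p) (x r - z))).
  have cx := abs_continuous_within x t act.
  have sub : `[s, t]%classic `<=` (`[0, t]%classic : set R).
    by move=> r /=; rewrite !in_itv/= => /andP[sr ->]; rewrite (le_trans s0).
  apply: (@integrableS _ _ _ mu `[0, t]%classic) => //.
  have cxz : {within `[0, t], continuous (fun r => x r - z)}.
    by move=> r; apply: cvgB; [exact: cx|exact: cvg_cst].
  have := integrable_ip ip ip_norm (fun r => x r - z) t (u + p) cxz.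
  by apply: eq_integrable => // r _; rewrite /= (ipC ip).
have iq := @integrableB _ _ _ mu `[s, t]%classic (measurable_itv _) _ _ (gap_integrable_itv s t s0) ic.
have acs : abs_continuous (energy z : R -> R^o) s t.
  have ac0 := abs_continuous_half_sqr_dist x z t t0 act.
  move=> e e0; have [d d0 dh] := ac0 e e0; exists d => // n v w vw; apply: dh.
  by move=> i; have [sv vwt] := vw i; split => //; exact: le_trans sv.
have := abs_continuous_le_Rintegral (energy z)
  (fun r => gap r - ip (u + p) (x r - z)) s t st acs iq.
rewrite RintegralB//; last exact: gap_integrable_itv.
rewrite lerBrDr; apply.
have := gap_fin; have := energy_inequality z u Psi_z Azu.
apply: filterS2 => [|r]; first exact: (ae_filter_ringOfSetsType mu).
move=> er gr /andP[sr rt]; have r0 : 0 < r by exact: le_lt_trans sr.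
have [c [xc dh hr]] := er r0; split => //.
have := le_fenchel_gap ip Psi p z (beta r) (x r) c xc.
rewrite gr ?(ltW r0)// lee_fin ipDl.
set D := (energy z)^`()%classic r in hr *; lra.
Qed.

End normal_direction.

(** The Young inequality for [2 p] costs only half of the penalty term, and
the other half is what remains to be integrated. The integral is a supremum over
simple functions below the integrand, so each of them may be integrated against
the energy in its place. *)
Lemma penalty_integral_lt (C : set H) (z p u : H) : Psi z = 0%E ->
  A z u -> u + p = 0 -> normal_cone ip C z (2 *: p) ->
  (\int[mu]_(t in `[0%R, +oo[)
     ((beta t)%:E * (fenchel_conjugate ip Psi ((beta t)^-1 *: (2 *: p))
                     - support_function ip C ((beta t)^-1 *: (2 *: p)))) < +oo)%E ->
  (\int[mu]_(t in `[0%R, +oo[) ((beta t)%:E * Psi (x t)) < +oo)%E.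
Proof.
move=> z0 Azu up0 pz gap_int.
set g := gap z (2 *: p).
pose M : R := 2 * energy z 0 + \int[mu]_(t in `[0, +oo[) g t.
have gT T : 0 <= T -> \int[mu]_(t in `[0, T]) g t <= \int[mu]_(t in `[0, +oo[) g t.
  exact: (gap_le_total C z (2 *: p) z0 pz gap_int).
apply: (@le_lt_trans _ _ M%:E); last exact: ltry.
set Phi := (fun t => (beta t)%:E * Psi (x t))%E.
have Phi0 t : (`[0, +oo[%classic : set R) t -> (0 <= Phi t)%E.
  by rewrite /= in_itv/= andbT => t0; rewrite mule_ge0// lee_fin ltW// beta_gt0.
rewrite ge0_integralE//; apply: ge_ereal_sup => _ [k /= kPhi <-].
have kD : k \_ (`[0, +oo[%classic : set R) = k :> (R -> R).
  apply/funext => t; rewrite patchE; case: ifPn => // /negP tD.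
  have := kPhi t; rewrite patchE memNset; last by move: tD; rewrite inE.
  by rewrite lee_fin => kt; apply/eqP; rewrite eq_le fun_ge0.
rewrite -kD -integral_nnsfun// ge0_integral_ereal_sup//; last first.
  exact: (@measurable_funPT _ _ _ _ k).
apply: ge_ereal_sup => _ [n _ <-].
set T : R := n.+1%:R; have T0 : 0 <= T by [].
have ik : mu.-integrable `[0, T] (EFin \o k).
  apply: measurable_bounded_integrable => //.
  - by rewrite /= lebesgue_measure_itv/=; case: ifP; rewrite ltry.
  - exact: measurable_funTS.
  - have [c [cr kc]] := simple_bounded k.
    by exists c; split => // y cy r _; exact: kc.
have ig : mu.-integrable `[0, T] (EFin \o g).
  exact: (gap_integrable_itv C z (2 *: p) z0 pz gap_int).
rewrite -[X in (X <= _)%E]fineK ?integrable_fin_num// lee_fin.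
have igk := @integrableB _ _ _ mu `[0, T]%classic (measurable_itv _) _ _ ig ik.
have iq : mu.-integrable `[0, T] (EFin \o (fun t => 2^-1 * (g t - k t))).
  exact: (@integrableZl _ _ _ mu `[0, T]%classic (measurable_itv _) (2^-1) _ igk).
have acE := abs_continuous_half_sqr_dist x z T T0 (solution_abs_continuous T T0).
have := abs_continuous_le_Rintegral (energy z) _ 0 T T0 acE iq.
rewrite RintegralZl// RintegralB//.
have bound : {ae mu, forall t, 0 < t < T ->
    derivable (energy z) t 1 /\ (energy z)^`()%classic t <= 2^-1 * (g t - k t)}.
  have := gap_fin C z (2 *: p) z0 pz gap_int; have := energy_inequality z u z0 Azu.
  apply: filterS2 => [|r]; first exact: (ae_filter_ringOfSetsType mu).
  move=> er gr /andP[r0 rT].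
  have [c [xc dh hr]] := er r0; split => //.
  have := le_fenchel_gap ip Psi (2 *: p) z (beta r) (x r) c xc.
  rewrite gr ?(ltW r0)// lee_fin ipZl -/g.
  have := kPhi r; rewrite patchE mem_set; last by rewrite /= in_itv/= (ltW r0).
  rewrite /Phi xc -EFinM lee_fin.
  have -> : ip p (x r - z) = - ip u (x r - z).
    by move/eqP: up0; rewrite addrC addr_eq0 => /eqP ->; rewrite ipNl.
  set D := (energy z)^`()%classic r in hr *; lra.
have arith (k' g' G e0 eT : R) : g' <= G -> 0 <= eT ->
    eT - e0 <= 2^-1 * (g' - k') -> k' <= 2 * e0 + G by lra.
move=> /(_ bound); exact: arith (gT T T0) (energy_ge0 z T).
Qed.

Section asymptotics.
Variable C : set H.
Hypothesis C_zero : forall z, C z -> Psi z = 0%E.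
Hypothesis gap_int : forall p, op_range (normal_cone ip C) p ->
  (\int[mu]_(t in `[0%R, +oo[)
     ((beta t)%:E * (fenchel_conjugate ip Psi ((beta t)^-1 *: p)
                     - support_function ip C ((beta t)^-1 *: p))) < +oo)%E.
Local Notation AN := (op_add A (normal_cone ip C)).

(** The growth estimate for a pair of the graph of [A + N_C], with the splitting
of [y] and the gap function of its normal part hidden behind [g]. *)
Lemma pair_growth z y : AN z y -> exists g M,
  [/\ forall s t, 0 <= \int[mu]_(r in `[s, t]) g r :> R,
      forall t, 0 <= t -> \int[mu]_(r in `[0, t]) g r <= M,
      forall s t, 0 <= s -> s <= t ->
        \int[mu]_(r in `[0, t]) g r = \int[mu]_(r in `[0, s]) g r + \int[mu]_(r in `[s, t]) g r
    & forall s t, 0 <= s -> s <= t ->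
        energy z t - energy z s + \int[mu]_(r in `[s, t]) ip y (x r - z)
        <= \int[mu]_(r in `[s, t]) g r].
Proof.
move=> [u Azu [p pz <-]].
have z0 : Psi z = 0%E by apply: C_zero; have [] := pz.
have gp : op_range (normal_cone ip C) p by exists z.
exists (gap z p), (\int[mu]_(s in `[0, +oo[) gap z p s); split.
- by move=> s t; apply: Rintegral_ge0 => r _; exact: gap_ge0.
- by move=> t t0; exact: (gap_le_total C z p z0 pz (gap_int p gp)).
- move=> s t s0 st.
  have gi r := gap_integrable_itv C z p z0 pz (gap_int p gp) 0 r (lexx _).
  rewrite -(@Rintegral_itv_obnd_cbnd _ s (BRight t)).
    by rewrite -(@Rintegral_itvB _ _ (BLeft 0) (BRight t) s)//= ?bnd_simp// addrC subrK.
  apply: integrableS (gi t) => // r /=; rewrite !in_itv/= => /andP[sr ->].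
  by rewrite (le_trans s0)// ltW.
- by move=> s t s0 st; exact: (energy_growth C z p z0 pz (gap_int p gp)).
Qed.

Let Rintegral_ip0 z s t : \int[mu]_(r in `[s, t]) ip 0 (x r - z) = 0.
Proof.
under eq_Rintegral do rewrite (ip0l ip).
by rewrite Rintegral_cst// mul0r.
Qed.

Lemma energy_bounded z : AN z 0 -> exists M, forall t, 0 <= t -> energy z t <= M.
Proof.
move=> /pair_growth[g [M [g0 gM gD gE]]]; exists (energy z 0 + M) => t t0.
by have := gE 0 t (lexx _) t0; have := gM t t0; rewrite Rintegral_ip0; lra.
Qed.

(** The integral of [g] is nondecreasing and bounded, and so is its difference
with the energy. *)
Lemma energy_cvg z : AN z 0 -> cvg (energy z t @[t --> +oo]).
Proof.
move=> /pair_growth[g [M [g0 gM gD gE]]].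
pose G t := \int[mu]_(r in `[0, t]) g r.
have cG : cvg (G t @[t --> +oo]).
  apply: (nondecreasing_bounded_cvg G M) => // s t s0 st.
  by rewrite /G (gD s t)// lerDl.
have cW : cvg (G t - energy z t @[t --> +oo]).
  apply: (nondecreasing_bounded_cvg (fun t => G t - energy z t) M).
    move=> s t s0 st; rewrite /G (gD s t)//; have := gE s t s0 st.
    by rewrite Rintegral_ip0; lra.
  by move=> t t0; rewrite lerBlDr (le_trans (gM t t0))// lerDl energy_ge0.
rewrite (_ : energy z = fun t => G t - (G t - energy z t)); first exact: is_cvgB.
by apply/funext => t; rewrite subKr.
Qed.

Lemma dist_cvg z : AN z 0 -> exists l : R, `|x t - z| @[t --> +oo] --> l.
Proof.
move=> /energy_cvg/cvg_ex[/= l zl]; exists (Num.sqrt (2 * l)).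
have : Num.sqrt (2 * energy z t) @[t --> +oo] --> Num.sqrt (2 * l).
  apply: (@cvg_comp _ _ _ (fun t => 2 * energy z t) Num.sqrt _ (nbhs (2 * l))).
    by apply: cvgM => //; exact: cvg_cst.
  exact: sqrt_continuous.
apply: cvg_trans; apply: near_eq_cvg; near=> t.
by rewrite /energy mulrC divfK// sqrtr_sqr normr_id.
Unshelve. all: by end_near. Qed.

Definition average t : H := t^-1 *: bochner_integral `[0, t] x.

Lemma ip_average t y : 0 <= t -> ip (average t) y = t^-1 * \int[mu]_(r in `[0, t]) ip (x r) y.
Proof.
move=> t0; rewrite /average ipZl (ip_bochner_integral ip ip_norm)//.
exact: solution_abs_continuous.
Qed.

Lemma ip_integrable t y : mu.-integrable `[0, t] (EFin \o (fun r => ip (x r) y)).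
Proof.
have [t0|t0] := leP 0 t.
  apply: (integrable_ip ip ip_norm); apply: abs_continuous_within.
  exact: solution_abs_continuous.
by rewrite set_itv_ge ?bnd_simp -?ltNge//; exact: integrable_set0.
Qed.

(** Pairing the average with itself bounds its squared norm by its norm times a
bound of the trajectory. *)
Lemma average_bounded z : AN z 0 -> exists M, \forall t \near +oo, `|average t| <= M.
Proof.
move=> /energy_bounded[K EK].
have xK t : 0 <= t -> `|x t| <= `|z| + Num.sqrt (2 * K).
  move=> t0; rewrite -{1}(subrK z (x t)) addrC (le_trans (ler_normD _ _))// lerD2l.
  rewrite -(normr_id (x t - z)) -sqrtr_sqr ler_wsqrtr//.
  by have := EK t t0; rewrite /energy; lra.
set M := `|z| + _ in xK; exists M; near=> t.
have t0 : 0 < t by near: t; apply: nbhs_pinfty_gt; rewrite num_real.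
have [->|m0] := eqVneq (average t) 0.
  by rewrite normr0; apply: le_trans (xK 0 _).
have nm0 : 0 < `|average t| by rewrite normr_gt0.
rewrite -(ler_pM2r nm0) -expr2 -ip_norm ip_average ?(ltW t0)//.
rewrite mulrC ler_pdivrMr//.
apply: (@le_trans _ _ (\int[mu]_(r in `[0, t]) (M * `|average t|))); last first.
  by rewrite Rintegral_cst_itv// ltW.
apply: le_Rintegral => //.
- exact: ip_integrable.
- apply: continuous_compact_integrable; first exact: segment_compact.
  by move=> r; exact: cvg_cst.
- move=> r; rewrite /= in_itv/= => /andP[r0 _].
  apply: le_trans (ler_norm _) _; apply: le_trans (cauchy_schwarz ip ip_norm _ _) _.
  by rewrite ler_pM2r// xK.
Unshelve. all: by end_near. Qed.

(** Along an ultrafilter at infinity the averaged monotonicity inequality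
passes to the weak limit, which is then monotonically related to the whole graph
of [A + N_C]; maximality does the rest. *)
Lemma average_cluster_zero (U : set_system R) v : maximal_monotone ip AN ->
  UltraFilter U -> pinfty_nbhs R `<=` U -> weakly_cvg ip average U v -> AN v 0.
Proof.
move=> [mAN maxAN] UU oU vU.
have related z y : AN z y -> ip y (v - z) <= 0.
  move=> /pair_growth[g [M [g0 gM gD gE]]].
  have bound t : 0 < t -> ip (average t) y - ip z y <= t^-1 * (energy z 0 + M).
    move=> t0; have t0' := ltW t0; rewrite ip_average// ler_pdivlMl// mulrBr mulVKf ?gt_eqF//.
    have -> : t * ip z y = \int[mu]_(r in `[0, t]) ip z y.
      by rewrite Rintegral_cst_itv// mulrC.
    have icst : mu.-integrable `[0, t] (EFin \o cst (ip z y)).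
      apply: continuous_compact_integrable; first exact: segment_compact.
      by move=> r; exact: cvg_cst.
    rewrite -RintegralB//; last exact: ip_integrable.
    have <- : \int[mu]_(r in `[0, t]) ip y (x r - z) =
        \int[mu]_(r in `[0, t]) (ip (x r) y - ip z y).
      by apply: eq_Rintegral => r _; rewrite (ipC ip) ipBl.
    by have := gE 0 t (lexx _) t0'; have := gM t t0'; have := energy_ge0 z t; lra.
  rewrite (ipC ip) ipBl.
  have lim1 : ip (average t) y - ip z y @[t --> U] --> ip v y - ip z y.
    by apply: cvgB; [exact: vU|exact: cvg_cst].
  have lim2 : t^-1 * (energy z 0 + M) @[t --> U] --> 0 * (energy z 0 + M).
    apply: cvgM; last exact: cvg_cst.
    apply: cvg_trans (_ : t^-1 @[t --> +oo] --> (0 : R)); first exact: cvg_app.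
    exact: cvg_inv_pinfty.
  rewrite -(mul0r (energy z 0 + M)); apply: ler_cvg_to lim1 lim2 _.
  apply: oU; near=> t; apply: bound; near: t; apply: nbhs_pinfty_gt; rewrite num_real.
  by [].
(* The graph of [A + N_C] with the pair [(v, 0)] adjoined is still monotone. *)
pose B z y := AN z y \/ (z = v /\ y = 0).
apply: (maxAN B) => [z w y y' [AB|[-> ->]] [AB'|[-> ->]]|z y ?|].
- exact: mAN.
- by rewrite subr0 -opprB (ipC ip) ipNl (ipC ip) oppr_ge0; exact: related.
- by rewrite sub0r ipNl oppr_ge0; exact: related.
- by rewrite !subrr (ip0l ip).
- by left.
- by right.
Unshelve. all: by end_near. Qed.

(** [<x t, v - w>] is an affine function of the difference of the energies at
[w] and [v]. *)
Lemma ip_average_cvg v w : AN v 0 -> AN w 0 -> cvg (ip (average t) (v - w) @[t --> +oo]).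
Proof.
move=> /energy_cvg cv /energy_cvg cw.
have : cvg (energy w t - energy v t + (`|v| ^+ 2 - `|w| ^+ 2) / 2 @[t --> +oo]).
  by apply: is_cvgD; [exact: is_cvgB|exact: is_cvg_cst].
move=> /cvg_ex[/= l cl]; apply/cvg_ex; exists l.
have xl : ip (x t) (v - w) @[t --> +oo] --> l.
  apply: cvg_trans cl; apply: near_eq_cvg; near=> t.
  by rewrite /energy !(sqr_normB ip ip_norm) ipBr; field.
apply: cvg_trans (cesaro_mean_cvg _ _ (fun t => ip_integrable t (v - w)) xl).
apply: near_eq_cvg; near=> t; rewrite ip_average//.
Unshelve. all: by end_near. Qed.

Lemma average_weakly_cvg : maximal_monotone ip AN -> (exists z, AN z 0) ->
  exists2 v, AN v 0 & weakly_cvg ip average +oo v.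
Proof.
move=> maxAN [z z0]; have [M mM] := average_bounded z z0.
apply: (opial ip ip_norm average (fun v => AN v 0) M mM).
- by move=> G v GU oG; exact: average_cluster_zero.
- exact: ip_average_cvg.
Qed.

End asymptotics.
End trajectory.

(** * Ergodic convergence *)

Theorem theorem2p1 (R : realType) (H : completeNormedModType R)
  (ip : {dot H for idfun}) (ip_norm : forall x : H, ip x x = `|x| ^+ 2)
  (A : H -> set H) (hA : maximal_monotone ip A)
  (Psi : H -> \bar R) (Psi_ge0 : forall x, (0 <= Psi x)%E)
  (Psi_closed : lower_semicontinuous Psi)
  (Psi_convex : convex_efun Psi) (Psi_proper : proper_efun Psi)
  (C : set H) (C_argmin : C = argmin Psi)
  (C_zeros : argmin Psi = Psi @^-1` [set 0%E]) (C_nonempty : C !=set0)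
  (beta : R -> R) (beta_meas : measurable_fun (`[0, +oo[%classic : set R) beta)
  (beta_gt0 : forall t, 0 <= t -> 0 < beta t)
  (beta_cvg : beta t @[t --> +oo] --> +oo)
  (S : set H) (S_def : S = op_inv (op_add A (normal_cone ip C)) 0)
  (ha : maximal_monotone ip (op_add A (normal_cone ip C)) /\ S !=set0)
  (hb : forall p, op_range (normal_cone ip C) p ->
    (\int[@lebesgue_measure R]_(t in `[0%R, +oo[)
       ((beta t)%:E * (fenchel_conjugate ip Psi ((beta t)^-1 *: p)
                       - support_function ip C ((beta t)^-1 *: p))) < +oo)%E)
  (x : R -> H) (hx : strong_solution ip A Psi beta x) :
  [/\ exists2 xinf : H, S xinf &
        weakly_cvg ip (fun t : R => t^-1 *: bochner_integral `[0, t] x)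
          +oo xinf,
      forall z, S z -> exists l : R, `|x t - z| @[t --> +oo] --> l
    & (\int[@lebesgue_measure R]_(t in `[0%R, +oo[)
         ((beta t)%:E * Psi (x t)) < +oo)%E].
Proof.
have C_zero c : C c -> Psi c = 0%E by rewrite C_argmin C_zeros.
have [A_mono _] := hA.
have [maxAN [z Sz]] := ha; subst S.
have AN0 : op_add A (normal_cone ip C) z 0 := Sz.
split.
- by apply: (average_weakly_cvg ip ip_norm A Psi beta x A_mono Psi_ge0 beta_meas
    beta_gt0 hx C C_zero hb maxAN); exists z.
- exact: (dist_cvg ip ip_norm A Psi beta x A_mono Psi_ge0 beta_meas
    beta_gt0 hx C C_zero hb).
- case: AN0 => u Azu [p [Cz pz] up0].
  have p2z : normal_cone ip C z (2 *: p).
    by split => // y Cy; rewrite ipZl pmulr_rle0// pz.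
  apply: (penalty_integral_lt ip ip_norm A Psi beta x A_mono Psi_ge0 beta_meas
    beta_gt0 hx C z p u (C_zero z Cz) Azu up0 p2z).
  by apply: hb; exists z.
Qed.
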